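(* Let $\ell$ be a positive integer with at least two distinct odd prime factors, and let $\omega$ be the number of distinct prime factors of $\ell$. Let $P^*_{\mathrm{odd}}(\ell)$ be the set of all odd primes dividing $\ell$ except for the smallest such prime, and set $\varepsilon=\frac{1}{20}\sum_{p\in P^*_{\mathrm{odd}}(\ell)} p^{-2}$. Then there is $n_0=n_0(\ell)$ such that for all $n\geq n_0$, \[ f_{\ell}(n)\leq \omega n-(2\omega+\varepsilon)\log_2 n . \]
   Context: For a positive integer $\ell$, an $\ell$-Oddtown on $[n]=\{1,\dots,n\}$ is a family $\mathcal{A}$ of subsets of $[n]$ such that $|A|\not\equiv 0 \pmod{\ell}$ for every $A\in\mathcal{A}$ and $|A\cap B|\equiv 0\pmod{\ell}$ for all distinct $A,B\in\mathcal{A}$. $f_\ell(n)$ denotes the maximum size of an $\ell$-Oddtown on $[n]$. *)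

(* Defs.v *)
From mathcomp Require Import all_boot.
From Stdlib Require Import Reals.
Set Implicit Arguments. Unset Strict Implicit. Unset Printing Implicit Defensive.

Definition oddtown (l n : nat) (F : {set {set 'I_n}}) : bool :=
  [forall A in F, ~~ (l %| #|A|)] &&
  [forall A in F, forall B in F, (A != B) ==> (l %| #|A :&: B|)].

Definition f_oddtown (l n : nat) : nat :=
  \max_(F : {set {set 'I_n}} | oddtown l F) #|F|.

Definition omega (l : nat) : nat := size (primes l).

(* odd primes dividing l, in increasing order *)
Definition odd_primes (l : nat) : seq nat := filter odd (primes l).

Definition Pstar_odd (l : nat) : seq nat := behead (odd_primes l).

Definition eps (l : nat) : R :=
  (/ 20 * foldr (fun p acc => / (INR p ^ 2) + acc) 0 (Pstar_odd l))%R.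

Definition log2 (x : R) : R := (ln x / ln 2)%R.

(* Main.v *)
Require Import Defs.
From mathcomp Require Import all_boot all_order all_algebra complex.
From mathcomp Require Import reals trigo zify ring lra.
Set Implicit Arguments. Unset Strict Implicit. Unset Printing Implicit Defensive.
Import Order.TTheory GRing.Theory Num.Theory.

(* Let F be an l-Oddtown and, for a prime q dividing l with q^b || l, let F_q be
   the subfamily of the sets whose size is nonzero mod q^b; these cover F.  If d
   is the rank over 'F_q of the incidence matrix of F \ F_q, whose rows are
   isotropic and orthogonal to F_q mod q^b, then |F_q| + 2 d <= n.  When |F| is
   close to omega * n, at least n/2 members of F \ F_q lie in a single F_p with
   p <> q; they are independent over the rationals, hence contain a nonsingular
   0/1 matrix M of order N >= n/2 whose rank over 'F_q is at most d.

   Since 0/1 vectors in a space of dimension d number at most 2^d, this gives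
   2 d >= 2 log2 (n/2).  For q >= 5 one does better.  Write M i j = x_i . c_j
   mod q with x_i in {0,1}^d, and sum |sum_j e(x . c_j / q)|^2 over all x in
   {0,1}^d.  The rows of M alone contribute at least N^3 cos(2 pi / q), whereas
   a pair of columns (c, c') contributes at most 2^d cos(pi / q)^wt(c - c'), and
   few columns are close to c because those that differ from c exactly on S
   number at most 2^|S|.  Hence N <= C * 2^(d (1 - 1/(8 q^2))). *)

Local Open Scope ring_scope.

(** * Linear algebra *)

(** In the Smith form [L * D * G] of [M], a zero row [i] of [D] makes row [i] of the inverse of [L]
    a relation, primitive since [L] is unimodular; without zero rows, [D] has a rational right
    inverse. *)
Lemma primitive_left_kernel m n (M : 'M[int]_(m, n)) (q : nat) :
  prime q -> ~~ row_free (map_mx intr M : 'M[rat]_(m, n)) ->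
  exists2 v : 'rV[int]_m, v *m M = 0 & exists i, ~~ (q %| v 0%R i)%Z.
Proof.
move=> pq; have [L uL [G uG [d _ defM]]] := int_Smith_normal_form M.
set D := \matrix_(i, j) _ in defM.
case: (boolP [exists i, row i D == 0]) => [/existsP[i /eqP Di0] _ | noi].
  exists (row i (invmx L)).
    rewrite defM -mulmxA -row_mul mulmxA mulVmx // mul1mx row_mul Di0.
    by rewrite mul0mx.
  apply/existsP; apply: contraT; rewrite negb_exists => /forallP dv.
  have: (q %| (row i (invmx L) *m L) 0%R i)%Z.
    rewrite mxE; apply: rpred_sum => j _.
    by apply: dvdz_mulr; move: (dv j); rewrite negbK.
  rewrite -row_mul mulVmx // !mxE.
 rewrite eqxx /= dvdz1 absz_nat => /eqP q1.
  by rewrite q1 in pq.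
case/negP; apply/row_freeP; have D0 (i : 'I_m) : exists j, D i j != 0.
  apply/existsP; apply: contraT; rewrite negb_exists => /forallP D0.
  case/negP: noi; apply/existsP; exists i; apply/eqP/rowP=> j.
  by rewrite !mxE; have := D0 j; rewrite negbK mxE => /eqP.
have {D0} dn0 (i : 'I_m) : (i < n)%N /\ d`_i != 0.
  have [j] := D0 i; rewrite mxE; case: (nat_of_ord i =P j) => [ij | _]; last by rewrite eqxx.
 
  by rewrite mulr1n => ->; rewrite ij; split=> //; exact: ltn_ord.
pose E := \matrix_(j < n, i < m) (((d`_i)%:~R : rat)^-1 *+ (i == j :> nat)).
have DE : map_mx intr D *m E = 1%:M.
  apply/matrixP=> i k; have [lt_in di] := dn0 i.
  rewrite !mxE (bigD1 (Ordinal lt_in)) //= big1 => [|j]; last first.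
    rewrite -val_eqE /= !mxE eq_sym => /negPf->; by rewrite mul0r.
  rewrite !mxE /= eqxx mulr1n addr0 -val_eqE /=.
  case: (nat_of_ord i =P k) => [<-|/eqP/negPf ik].
    by rewrite eqxx mulr1n mulfV // intr_eq0.
  by rewrite eq_sym ik mulr0n mulr0.
exists (invmx (map_mx intr G) *m E *m invmx (map_mx intr L)).
have uL' : (map_mx intr L : 'M[rat]_m) \in unitmx.
  by rewrite unitmxE det_map_mx rmorph_unit // -unitmxE.
have uG' : (map_mx intr G : 'M[rat]_n) \in unitmx.
  by rewrite unitmxE det_map_mx rmorph_unit // -unitmxE.
rewrite defM !map_mxM -!mulmxA (mulmxA _ (invmx _)) mulmxV // mul1mx.
by rewrite (mulmxA _ E) DE mul1mx mulmxV.
Qed.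

Lemma prime_dvdz_mul_pow (q b : nat) (x y : int) : prime q ->
  ((q ^ b)%N %| x * y)%Z -> ~~ ((q ^ b)%N %| x)%Z -> (q %| y)%Z.
Proof.
move=> pq dv; apply: contraR => nqy; move: dv; rewrite Gauss_dvdzl //.
by rewrite coprimezE !absz_nat coprimeXl // prime_coprime.
Qed.

(* The argument is q-adic: a primitive integral relation between the rows of
   A would be divisible by q. *)
Lemma row_free_diag_gram m n (A : 'M[int]_(m, n)) (q b : nat) : prime q ->
  (forall i j, i != j -> ((q ^ b)%N %| (A *m A^T) i j)%Z) ->
  (forall i, ~~ ((q ^ b)%N %| (A *m A^T) i i)%Z) ->
  row_free (map_mx intr A : 'M[rat]_(m, n)).
Proof.
move=> pq offd ond; apply: contraT => /(primitive_left_kernel pq)[v vA [k]].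
case/negP; apply: (@prime_dvdz_mul_pow q b ((A *m A^T) k k)) => //.
have /matrixP/(_ 0 k) : v *m (A *m A^T) = 0 by rewrite mulmxA vA mul0mx.
rewrite mxE [RHS]mxE (bigD1 k) //= addrC => /eqP; rewrite addr_eq0 => /eqP vi.
rewrite mulrC -[X in (_ %| X)%Z]opprK -vi rpredN rpred_sum // => j ij.
by rewrite dvdz_mull // offd.
Qed.

Lemma Fp_intr_eq0 (q : nat) (x : int) : prime q ->
  (x%:~R == 0 :> 'F_q) = (q %| x)%Z.
Proof. by move=> pq; rewrite (dvdz_pcharf (pchar_Fp pq)). Qed.

(** A row basis of the transpose gives a column basis of [A]; column [j] of [K] holds the
    coordinates of column [j] of [A] in it. *)
Lemma colsub_row_free (F : fieldType) m n (A : 'M[F]_(m, n)) :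
  exists f : 'I_(\rank A) -> 'I_n,
    row_free (colsub f A)^T /\ exists K, A = colsub f A *m K.
Proof.
have eT : \rank A = \rank A^T by rewrite mxrank_tr.
pose f i := maxrankfun A^T (cast_ord eT i); exists f.
have tE : (colsub f A)^T = rowsub f A^T by apply/matrixP=> i j; rewrite !mxE.
have fE : (rowsub f A^T :=: A^T)%MS.
  apply: eqmx_trans (eq_maxrowsub A^T); apply/eqmxP/andP.
  split; apply/row_subP=> i; rewrite row_rowsub.
    have := row_sub (cast_ord eT i) (rowsub (maxrankfun A^T) A^T).
    by rewrite row_rowsub.
  have := row_sub (cast_ord (esym eT) i) (rowsub f A^T).
  by rewrite row_rowsub /f cast_ordKV.
split; first by rewrite tE /row_free fE mxrank_tr.
have /submxP[D /(congr1 trmx)] : (A^T <= rowsub f A^T)%MS by rewrite fE.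
by rewrite trmxK trmx_mul -tE trmxK => AE; exists D^T.
Qed.

(* The rows of A and B, together with the unit vectors at d columns where B is
   invertible mod q, are independent over the rationals. *)
Lemma oddtown_isotropic_bound m r n (A : 'M[int]_(m, n)) (B : 'M[int]_(r, n))
    (q b : nat) : prime q -> (0 < b)%N ->
  (forall i j, i != j -> ((q ^ b)%N %| (A *m A^T) i j)%Z) ->
  (forall i, ~~ ((q ^ b)%N %| (A *m A^T) i i)%Z) ->
  (forall i j, ((q ^ b)%N %| (A *m B^T) i j)%Z) ->
  (forall i j, ((q ^ b)%N %| (B *m B^T) i j)%Z) ->
  (m + (\rank (map_mx intr B : 'M['F_q]_(r, n))).*2 <= n)%N.
Proof.
move=> pq b0 offd ond AB BB.
set Bq := map_mx intr B; set d : nat := \rank Bq.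
have qb : (q %| Posz (q ^ b))%Z by rewrite dvdzE /= dvdn_exp.
pose h : 'I_d -> 'I_r := maxrankfun Bq; pose B1 := rowsub h B.
have B1q : (map_mx intr B1 : 'M['F_q]_(d, n)) = rowsub h Bq.
  by apply/matrixP=> i j; rewrite !mxE.
have B1free : row_free (rowsub h Bq) := maxrowsub_free Bq.
have rB1 : \rank (rowsub h Bq) = d by apply/eqP.
have [g [gfree _]] := colsub_row_free (rowsub h Bq).
rewrite rB1 in g gfree.
(* The unit vectors at the columns [g]: [W] is then the transpose of a square submatrix of [B1] that
   is invertible mod q. *)
pose C : 'M[int]_(d, n) := \matrix_(i, j) (g i == j)%:R.
pose W := C *m B1^T.
have WE : W = (colsub g B1)^T.
  apply/matrixP=> i j; rewrite !mxE (bigD1 (g i)) //= big1 ?addr0.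
    by rewrite !mxE eqxx mul1r.
  by move=> k; rewrite !mxE eq_sym => /negPf->; rewrite mul0r.
have Wq : map_mx intr W = (colsub g (rowsub h Bq))^T :> 'M['F_q]_d.
  by rewrite WE; apply/matrixP=> i j; rewrite !mxE.
have Wu : coprimez (Posz (q ^ b)) (\det W).
  rewrite coprimezE absz_nat coprimeXl // prime_coprime //.
  have := gfree; rewrite row_free_unit -Wq unitmxE unitfE det_map_mx.
  by rewrite Fp_intr_eq0 // dvdzE absz_nat.
pose M := col_mx A (col_mx B1 C).
suff : row_free (map_mx intr M : 'M[rat]_(_, n)).
  by rewrite /row_free => /eqP Mr; rewrite -addnn -[X in (X <= _)%N]Mr rank_leq_col.
apply: contraT => /(primitive_left_kernel pq)[v vM [i /negP[]]].
rewrite -[v]hsubmxK -[rsubmx v]hsubmxK in vM *.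
move: (lsubmx v) (lsubmx (rsubmx v)) (rsubmx (rsubmx v)) vM => al be ga.
rewrite !mul_row_col => vM.
have B1B1 i1 i2 : ((q ^ b)%N %| (B1 *m B1^T) i1 i2)%Z.
  have -> : (B1 *m B1^T) i1 i2 = (B *m B^T) (h i1) (h i2).
    by rewrite !mxE; apply: eq_bigr => k _; rewrite !mxE.
  exact: BB.
have AB1 i1 i2 : ((q ^ b)%N %| (A *m B1^T) i1 i2)%Z.
  have -> : (A *m B1^T) i1 i2 = (A *m B^T) i1 (h i2).
    by rewrite !mxE; apply: eq_bigr => k _; rewrite !mxE.
  exact: AB.
have dvsum k l (x : 'rV[int]_k) (Y : 'M[int]_(k, l)) j :
    (forall i, ((q ^ b)%N %| x 0%R i * Y i j)%Z) ->
    ((q ^ b)%N %| (x *m Y) 0%R j)%Z.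
  by move=> xY; rewrite mxE rpred_sum.
(* Multiplying the relation by [B1^T] kills the first two blocks mod [q ^ b], and the determinant of
   [W] is prime to q. So [ga] vanishes modulo the full power [q ^ b], as is required before
   multiplying by [A^T]. *)
have gaW j : ((q ^ b)%N %| (ga *m W) 0%R j)%Z.
  have /matrixP/(_ 0 j) := congr1 (mulmx^~ B1^T) vM.
  rewrite mul0mx !mulmxDl -!mulmxA [RHS]mxE addrA mxE addrC => /eqP.
  rewrite addr_eq0 => /eqP ->; rewrite rpredN mxE rpredD //.
    by apply: dvsum => k; rewrite dvdz_mull.
  by apply: dvsum => k; rewrite dvdz_mull.
have gaq j : ((q ^ b)%N %| ga 0%R j)%Z.
  have : ((q ^ b)%N %| (ga *m W *m \adj W) 0%R j)%Z.
    by apply: dvsum => k; rewrite dvdz_mulr.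
  by rewrite -mulmxA mul_mx_adj mul_mx_scalar mxE Gauss_dvdzr.
(* Only the diagonal term survives mod [q ^ b]. Its diagonal factor may contain up to b - 1 factors
   q, so just q itself is known to divide [al]. *)
have alq j : (q %| al 0%R j)%Z.
  apply: (@prime_dvdz_mul_pow q b ((A *m A^T) j j)) => //.
  have /matrixP/(_ 0 j) := congr1 (mulmx^~ A^T) vM.
  rewrite mul0mx !mulmxDl -!mulmxA [RHS]mxE mxE => /eqP.
  rewrite mxE (bigD1 j) //= -addrA addr_eq0 mulrC => /eqP ->.
  rewrite rpredN rpredD ?rpred_sum // => [k kj|].
    by rewrite dvdz_mull // offd.
  rewrite mxE rpredD //; apply: dvsum => k; last by rewrite dvdz_mulr.
  by rewrite dvdz_mull // -[B1 *m A^T]trmxK trmx_mul trmxK mxE.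
(* With [al] and [ga] zero mod q, what remains is a relation between rows independent over
   ['F_q]. *)
have beq j : (q %| be 0%R j)%Z.
  have be0 : map_mx intr be *m rowsub h Bq = 0 :> 'rV['F_q]_n.
    move: vM => /(congr1 (map_mx (intr : int -> 'F_q))).
    rewrite !map_mxD map_mx0 !map_mxM.
    have -> : map_mx intr al = 0 :> 'rV['F_q]_m.
      by apply/rowP=> k; rewrite !mxE; apply/eqP; rewrite Fp_intr_eq0.
    have -> : map_mx intr ga = 0 :> 'rV['F_q]_d.
      apply/rowP=> k; rewrite !mxE; apply/eqP; rewrite Fp_intr_eq0 //.
      exact: dvdz_trans qb (gaq k).
    by rewrite !mul0mx add0r addr0 B1q.
  have : map_mx intr be = 0 :> 'rV['F_q]_d.
    by apply: (row_free_inj B1free); rewrite mul0mx.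
  by move=> /rowP/(_ j)/eqP; rewrite !mxE Fp_intr_eq0.
rewrite mxE; case: (split i) => // k; rewrite mxE; case: (split k) => // k'.
exact: dvdz_trans qb (gaq k').
Qed.

(** A row is determined by its entries in a column basis, where each entry is one of two values. The
    offsets [a] serve for differences of 0/1 vectors with a fixed one. *)
Lemma card_rows_two_valued (F : fieldType) t m (V : 'M[F]_(t, m))
    (a : 'I_m -> F) (b : 'I_t -> 'I_m -> bool) :
  (forall j i, V j i = a i + (b j i)%:R) -> injective (fun j => row j V) ->
  (t <= 2 ^ \rank V)%N.
Proof.
move=> VE injV; have [f [_ [K VK]]] := colsub_row_free V.
pose code j : {ffun 'I_(\rank V) -> bool} := [ffun k => b j (f k)].
suff /leq_card : injective code.
  by rewrite card_ord card_ffun card_bool card_ord.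
move=> j1 j2 /ffunP ec; apply: injV.
rewrite VK !row_mul; congr (_ *m _); apply/rowP=> k; rewrite !mxE !VE.
by have := ec k; rewrite !ffunE => ->.
Qed.

Definition binary_rank q N (M : 'I_N -> 'I_N -> bool) : nat :=
  \rank (\matrix_(i, j) (M i j)%:R : 'M['F_q]_N).

(** Gives the coefficient 2 of the logarithm at a prime outside [Pstar_odd]. *)
Lemma le_exp_binary_rank q N (M : 'I_N -> 'I_N -> bool) :
  (forall i i', M i =1 M i' -> i = i') -> (N <= 2 ^ binary_rank q M)%N.
Proof.
move=> injr; apply: (@card_rows_two_valued _ _ _ _ (fun=> 0) M).
  by move=> i j; rewrite mxE add0r.
move=> i i' /rowP ii'; apply: injr => j; have := ii' j; rewrite !mxE.
by case: (M i j) (M i' j) => [] [] // /eqP; rewrite ?(eq_sym 0) oner_eq0.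
Qed.

(** * Trigonometric sums over the cube *)

Section Trigonometry.
Variable R : realType.
Implicit Types x t : R.

Lemma cos_addn2pi x n : cos (x + pi *+ 2 *+ n) = cos x.
Proof. exact: (periodicn (@cosD2pi R)). Qed.

Lemma sin_addn2pi x n : sin (x + pi *+ 2 *+ n) = sin x.
Proof. exact: (periodicn (@sinD2pi R)). Qed.

Lemma norm_sin_mulrn x n : `|sin (x *+ n)| <= n%:R * `|sin x|.
Proof.
elim: n => [|n IHn]; first by rewrite mulr0n sin0 normr0 mul0r.
rewrite mulrS sinD (le_trans (ler_normD _ _)) // !normrM -natr1 mulrDl mul1r addrC.
apply: lerD; last by rewrite ler_piMr // cos_max.
by rewrite (le_trans _ IHn) // ler_piMl // cos_max.
Qed.

(** With y = pi / (2q): 1 = sin(q y) <= q |sin y|, and cos(2y) = 1 - 2 sin(y)^2. *)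
Lemma cos_pi_div_le (q : nat) : (0 < q)%N ->
  cos (pi / q%:R) <= 1 - 2 / q%:R ^+ 2 :> R.
Proof.
move=> q0; have q0' : 0 < q%:R :> R by rewrite ltr0n.
pose y : R := pi / 2 / q%:R.
have yq : y *+ q = pi / 2 by rewrite -[LHS]mulr_natr /y; field; rewrite gt_eqF.
have -> : pi / q%:R = y *+ 2 by rewrite /y; field; rewrite gt_eqF.
rewrite cos_mulr2n cos2sin2.
have := norm_sin_mulrn y q; rewrite yq sin_pihalf normr1 => h.
have {}h : q%:R ^-1 <= `|sin y| by rewrite -ler_pdivrMl // in h; rewrite mulr1 in h.
have : (q%:R ^-1) ^+ 2 <= `|sin y| ^+ 2 by rewrite lerXn2r // nnegrE invr_ge0 ltW.
rewrite real_normK ?num_real // exprVn; lra.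
Qed.

(** Cosine decreases on [0, pi], and x -> pi - x, which exchanges [a] and [q - a], turns the lower
    bound into an upper one. *)
Lemma norm_cos_le (q a : nat) : (0 < a < q)%N ->
  `|cos (pi * a%:R / q%:R)| <= cos (pi / q%:R) :> R.
Proof.
case/andP=> a0 aq; have q0 : (0 < q)%N := ltn_trans a0 aq.
have q0' : 0 < q%:R :> R by rewrite ltr0n.
have pi0 := pi_gt0 R.
have mono (z : R) : pi / q%:R <= z <= pi -> cos z <= cos (pi / q%:R).
  move=> /andP[z1 z2]; rewrite leNgt ltr_cos ?in_itv /= -?leNgt //.
    by rewrite z2 (le_trans _ z1) // divr_ge0 // ltW.
  apply/andP; split; first by apply: divr_ge0; apply: ltW.
  by rewrite ler_pdivrMr // ler_peMr ?ler1n // ltW.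
have a1 : 1 <= a%:R :> R by rewrite ler1n.
have aq1 : a%:R + 1 <= q%:R :> R by rewrite natr1 ler_nat.
rewrite ler_norml; apply/andP; split.
  rewrite lerNl.
  have -> : - cos (pi * a%:R / q%:R) = cos (pi - pi * a%:R / q%:R) :> R.
    by rewrite cosB cospi sinpi mul0r addr0 mulN1r.
  have -> : pi - pi * a%:R / q%:R = pi * (q%:R - a%:R) / q%:R :> R.
    by field; rewrite gt_eqF.
  apply: mono; rewrite ler_pM2r ?invr_gt0 // ler_pMr // ler_pdivrMr // ler_pM2l //.
  lra.
apply: mono; rewrite ler_pM2r ?invr_gt0 // ler_pMr // ler_pdivrMr // ler_pM2l //.
lra.
Qed.

Lemma norm_cos_sub_le (q a b : nat) : (a < q)%N -> (b < q)%N -> a != b ->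
  `|cos (pi * (a%:R - b%:R) / q%:R)| <= cos (pi / q%:R) :> R.
Proof.
wlog lt : a b / (a < b)%N => [th aq bq ab | aq bq _].
  have [lt|lt|e] := ltngtP a b; first exact: th.
    by rewrite -cosN -mulNr -mulrN opprB th // eq_sym.
  by rewrite e eqxx in ab.
rewrite -cosN -mulNr -mulrN opprB -(natrB _ (ltnW lt)); apply: norm_cos_le.
by rewrite subn_gt0 lt (leq_ltn_trans (leq_subr _ _) bq).
Qed.

Let e t : R[i] := (cos t +i* sin t)%C.

Let eD t u : e (t + u) = e t * e u.
Proof. rewrite /e cosD sinD; simpc. congr (_ +i* _)%C; ring. Qed.

Let e0 : e 0 = 1.
Proof. by rewrite /e cos0 sin0. Qed.

(** Real part of a sum of exponentials that factors over the coordinates, with 1 + e(t) = 2 cos(t/2)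
    e(t/2). *)
Lemma sum_cos_cube d (t : 'I_d -> R) (phi : R) :
  \sum_(x : {ffun 'I_d -> bool}) cos (phi + \sum_(i < d) (x i)%:R * t i) =
  cos (phi + \sum_(i < d) t i / 2) * \prod_(i < d) (2 * cos (t i / 2)).
Proof.
have e_sum (F : 'I_d -> R) : e (\sum_i F i) = \prod_i e (F i).
  exact: (big_morph e eD e0).
suff : \sum_(x : {ffun 'I_d -> bool}) e (phi + \sum_(i < d) (x i)%:R * t i) =
    e (phi + \sum_(i < d) t i / 2) * (\prod_(i < d) (2 * cos (t i / 2)))%:C%C.
  move=> /(congr1 (@complex.Re R)); rewrite raddf_sum /= => ->.
  by rewrite mulr0 subr0.
under eq_bigr do rewrite eD e_sum.
rewrite -mulr_sumr -(bigA_distr_bigA (fun i (b : bool) => e (b%:R * t i))).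
rewrite eD e_sum rmorph_prod -mulrA -big_split /=; congr (_ * _).
apply: eq_bigr => i _; rewrite big_bool /= mul1r mul0r e0 addrC.
have ti : t i = t i / 2 + t i / 2 by lra.
rewrite [in e (t i)]ti eD /e; simpc; congr (_ +i* _)%C; last by lra.
have := cos2Dsin2 (t i / 2); rewrite !expr2; lra.
Qed.

End Trigonometry.

(** * Ranks of 0/1 matrices over 'F_q *)

Section BinaryMatrix.
Variables (q N : nat) (M : 'I_N -> 'I_N -> bool).
Hypothesis pq : prime q.
Hypothesis injr : forall i i', M i =1 M i' -> i = i'.
Hypothesis injc : forall j j', (forall i, M i j = M i j') -> j = j'.

Let V : 'M['F_q]_N := \matrix_(i, j) (M i j)%:R.
Let d : nat := \rank V.
Variables (f : 'I_d -> 'I_N) (K : 'M['F_q]_(d, N)).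
Hypothesis VE : V = colsub f V *m K.

(** Column [j] of [K] is the vector c_j of the outline at the top; [supp j j'] is where c_j and c_j'
    differ. *)
Let supp j j' : {set 'I_d} := [set k | K k j' != K k j].

Let Fq_natb (b b' : bool) : b%:R = b'%:R :> 'F_q -> b = b'.
Proof. by case: b b' => [] [] // /eqP; rewrite ?(eq_sym 0) oner_eq0. Qed.

(** The differences between such columns of [V] and column [j] factor through the coordinates in
    [S], so they span a space of dimension at most |S|, and each of their entries is one of two
    values fixed by [M i j]. *)
Lemma card_supp_eq j S : (#|[set j' | supp j j' == S]| <= 2 ^ #|S|)%N.
Proof.
set T := [set _ | _]; pose jt (t : 'I_#|T|) : 'I_N := enum_val t.
pose W := \matrix_(t < #|T|, i < N) (V i (jt t) - V i j).
have VKE i j' : V i j' = \sum_k (M i (f k))%:R * K k j'.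
  by rewrite {1}VE mxE; apply: eq_bigr => k _; rewrite !mxE.
have rW : (\rank W <= #|S|)%N.
  have -> : W = (\matrix_(t < #|T|, s < #|S|)
        (K (enum_val s) (jt t) - K (enum_val s) j)) *m
      (\matrix_(s < #|S|, i < N) (M i (f (enum_val s)))%:R).
    apply/matrixP=> t i; rewrite mxE [RHS]mxE !VKE -sumrB.
    transitivity (\sum_(k in S) (K k (jt t) - K k j) * (M i (f k))%:R).
      rewrite [RHS]big_mkcond; apply: eq_bigr => k _.
      rewrite -mulrBr mulrC; case: ifPn => // kS.
      have := enum_valP t; rewrite inE => /eqP tS.
      by move: kS; rewrite -tS inE negbK => /eqP->; rewrite subrr mul0r.
    by rewrite big_enum_val; apply: eq_bigr => s _; rewrite !mxE.
  exact: mulmx_max_rank.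
apply: leq_trans (leq_pexp2l _ rW) => //.
apply: (@card_rows_two_valued _ _ _ W (fun i => - V i j) (fun t i => M i (jt t))).
  by move=> t i; rewrite !mxE addrC.
move=> t1 t2 /rowP tt; apply: enum_val_inj; apply: injc => i; apply: Fq_natb.
by have := tt i; rewrite !mxE => /addIr.
Qed.

(** Exponential weights: for |S| <= k, 2^|S| <= 16^k / 8^|S|, and the sum of 8^(d - |S|) over all S
    is 9^d. *)
Lemma card_supp_le j k :
  (8 ^ d * #|[set j' | (#|supp j j'| <= k)%N]| <= 16 ^ k * 9 ^ d)%N.
Proof.
have -> : #|[set j' | (#|supp j j'| <= k)%N]| =
    (\sum_(S : {set 'I_d} | (#|S| <= k)%N) #|[set j' | supp j j' == S]|)%N.
  rewrite -sum1_card (partition_big (supp j) (fun S => #|S| <= k)%N) /=;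
    last by move=> j'; rewrite inE.
  apply: eq_bigr => S Sk; rewrite -sum1_card; apply: eq_bigl => j'.
  by rewrite !inE; case: eqP => [->|]; rewrite ?Sk ?andbF.
have -> : (9 ^ d = \sum_(S : {set 'I_d}) 8 ^ #|~: S|)%N.
  have := @bigA_distr nat 0%N 1%N muln addn 'I_d (fun=> 1%N) (fun=> 8%N).
  rewrite prod_nat_const card_ord => ->; apply: eq_bigr => S _.
  rewrite (bigID (mem S)) /= big1 => [|i ->] //.
  rewrite mul1n -prod_nat_const; apply: eq_big => i; rewrite ?inE //.
  by move/negPf->.
rewrite !big_distrr /= big_mkcond /=; apply: leq_sum => S _; case: ifP => // Sk.
have dE : (#|S| + #|~: S| = d)%N by rewrite cardsC card_ord.
rewrite -{1}dE expnD mulnAC leq_mul2r; apply/orP; right.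
apply: leq_trans (leq_mul (leqnn _) (card_supp_eq j S)) _.
by rewrite -expnMn leq_exp2l.
Qed.

Variable R : realType.

(** [kap] and [s] lift c_j and x . c_j to natural numbers, [om] is 2 pi / q, and [X i] is the cube
    point x_i of row [i], so that [th j x] is the angle of e(x . c_j / q). *)
Let kap j k : nat := K k j.
Let s j (x : {ffun 'I_d -> bool}) : nat := (\sum_k x k * kap j k)%N.
Let om : R := pi / q%:R *+ 2.
Let th j x : R := om * (s j x)%:R.
Let X i : {ffun 'I_d -> bool} := [ffun k => M i (f k)].
Let rho : R := cos (pi / q%:R).

Let q0 : (0 < q)%N := prime_gt0 pq.
Let qR : q%:R != 0 :> R.
Proof. by rewrite pnatr_eq0 -lt0n. Qed.

Let X_inj : injective X.
Proof.
move=> i i' XX; apply: injr => j; apply: Fq_natb.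
have Vij i0 : (M i0 j)%:R = V i0 j by rewrite mxE.
rewrite !Vij VE !mxE; apply: eq_bigr => k _; rewrite !mxE.
by have /ffunP/(_ k) := XX; rewrite !ffunE => ->.
Qed.

Let s_X i j : exists k, s j (X i) = (M i j + q * k)%N.
Proof.
exists (s j (X i) %/ q)%N; rewrite {1}(divn_eq (s j (X i)) q) addnC mulnC.
congr (_ + _)%N; have := congr1 val (_ : (s j (X i))%:R = (M i j)%:R :> 'F_q).
rewrite /= !val_Fp_nat // => ->; first last.
  have -> : (M i j)%:R = V i j by rewrite mxE.
  rewrite VE mxE natr_sum; apply: eq_bigr => k _.
  by rewrite natrM natr_Zp ffunE !mxE.
by rewrite modn_small //; case: (M i j); rewrite // prime_gt1.
Qed.

Let trig_X i j : (cos (th j (X i)) = cos (om * (M i j)%:R)) *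
                 (sin (th j (X i)) = sin (om * (M i j)%:R)).
Proof.
have [k sk] := s_X i j.
have -> : th j (X i) = om * (M i j)%:R + pi *+ 2 *+ k.
  rewrite /th sk natrD natrM mulrDr; congr (_ + _).
  by rewrite /om -[RHS]mulr_natr; field; exact: qR.
by rewrite cos_addn2pi sin_addn2pi.
Qed.

Let G x : R := \sum_j \sum_j' cos (th j x - th j' x).

Let G_ge0 x : 0 <= G x.
Proof.
have -> : G x = (\sum_j cos (th j x)) ^+ 2 + (\sum_j sin (th j x)) ^+ 2.
  rewrite !expr2 !big_distrlr -big_split /=; apply: eq_bigr => j _.
  by rewrite -big_split /=; apply: eq_bigr => j' _; rewrite cosB.
by rewrite addr_ge0 ?sqr_ge0.
Qed.

Hypothesis q_gt4 : (4 < q)%N.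

(** As q >= 5, the angle 2 pi / q lies below pi / 2; for q = 3 its cosine is negative. *)
Lemma cos_om_gt0 : 0 < cos om.
Proof.
apply: cos_gt0_pihalf.
have q4 : 4 < q%:R :> R by rewrite ltr_nat.
have pi0 := pi_gt0 R.
have -> : om = pi * 2 / q%:R by rewrite /om; field; exact: qR.
have om0 : 0 < pi * 2 / q%:R :> R by rewrite divr_gt0 ?mulr_gt0 // (lt_trans _ q4).
apply/andP; split; first by rewrite (lt_trans _ om0) // oppr_lt0 divr_gt0.
rewrite -mulrA ltr_pM2l // ltr_pdivrMr ?(lt_trans _ q4) //; lra.
Qed.

(** At a row point every angle is 0 or [om] up to full turns, so all N^2 differences have cosine 1
    or cos om. *)
Let G_X i : N%:R ^+ 2 * cos om <= G (X i).
Proof.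
have -> : N%:R ^+ 2 * cos om = \sum_(j < N) \sum_(j' < N) cos om.
  by rewrite !sumr_const card_ord -[RHS]mulr_natr -[cos om *+ N]mulr_natr; ring.
apply: ler_sum => j _; apply: ler_sum => j' _.
rewrite cosB !trig_X -cosB -mulrBr.
have c1 := cos_le1 om.
by case: (M i j) (M i j') => [] []; rewrite ?subrr ?mulr0 ?cos0 // ?subr0 ?sub0r ?mulrN ?cosN mulr1.
Qed.

(** Each coordinate of [supp j j'] gives a factor at most 2 rho in [sum_cos_cube], every other one
    at most 2. *)
Let wt_bound j j' :
  \sum_(x : {ffun 'I_d -> bool}) cos (th j x - th j' x) <=
    2 ^+ d * rho ^+ #|supp j j'|.
Proof.
pose t k : R := om * ((kap j k)%:R - (kap j' k)%:R).
have thE x : th j x - th j' x = 0 + \sum_k (x k)%:R * t k.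
  rewrite add0r /th -mulrBr /s !natr_sum -sumrB mulr_sumr.
  by apply: eq_bigr => k _; rewrite !natrM /t; ring.
under eq_bigr do rewrite thE.
rewrite sum_cos_cube (le_trans (ler_norm _)) // normrM.
rewrite (le_trans (ler_piMl _ (cos_max _))) // normr_prod.
have -> : 2 ^+ d * rho ^+ #|supp j j'| =
    \prod_(k < d) (2 * (if k \in supp j j' then rho else 1)).
  rewrite big_split /= prodr_const card_ord -big_mkcond /=.
  by rewrite prodr_const.
apply: ler_prod => k _; rewrite normr_ge0 normrM ger0_norm // ler_pM2l //=.
rewrite inE; case: eqP => [e | ne] /=; first exact: cos_max.
have -> : t k / 2 = pi * ((kap j k)%:R - (kap j' k)%:R) / q%:R.
  by rewrite /t /om; field; exact: qR.
have ltq j0 : (kap j0 k < q)%N.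
  by rewrite /kap -[X in (_ < X)%N](Fp_cast pq) ltn_ord.
by apply: norm_cos_sub_le => //; apply/eqP => /val_inj/esym.
Qed.

Let mul_card (z : R) : N%:R * z = \sum_(j < N) z.
Proof. by rewrite sumr_const card_ord mulr_natl. Qed.

Let rho_ge0 : 0 <= rho.
Proof. by apply: le_trans (@norm_cos_le R q 1 _); rewrite // (ltn_trans _ q_gt4). Qed.

Let sum_rho j k :
  (\sum_j' rho ^+ #|supp j j'|) * 8 ^+ d <=
  16 ^+ k * 9 ^+ d + N%:R * rho ^+ k.+1 * 8 ^+ d.
Proof.
have rho1 : rho <= 1 := cos_le1 _.
rewrite (bigID (fun j' => (#|supp j j'| <= k)%N)) /= mulrDl lerD //.
  apply: (@le_trans _ _ (#|[set j' | (#|supp j j'| <= k)%N]|%:R * 8 ^+ d)).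
    rewrite ler_pM2r ?exprn_gt0 // cardE -sum1_size natr_sum big_enum /=.
    rewrite [leRHS](eq_bigl (fun j' => #|supp j j'| <= k)%N) => [|j']; last by rewrite inE.
    by apply: ler_sum => j' _; rewrite exprn_ile1.
  by have := card_supp_le j k; rewrite mulnC -!natrX -!natrM ler_nat.
rewrite ler_pM2r ?exprn_gt0 // mul_card big_mkcond /=; apply: ler_sum => j' _; case: ifP; last by rewrite exprn_ge0.
by rewrite -ltnNge => lt; rewrite ler_wiXn2l.
Qed.

(** Up to the factor [8 ^+ d], both sides bound the sum of [G] over the cube, divided by [N]: from
    below by its distinct row points, from above by exchanging sums and applying [wt_bound]. *)
Lemma binary_matrix_bound k : N%:R ^+ 2 * cos om * 8 ^+ d <=
  2 ^+ d * (16 ^+ k * 9 ^+ d + N%:R * rho ^+ k.+1 * 8 ^+ d) :> R.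
Proof.
have e8 : 0 < 8 ^+ d :> R by rewrite exprn_gt0.
case: (posnP N) => [N0 | N0].
  rewrite [N in N%:R ^+ 2]N0 expr0n /= !mul0r mulr_ge0 ?exprn_ge0 // addr_ge0 //.
    by rewrite mulr_ge0 ?exprn_ge0.
  by rewrite !mulr_ge0 ?exprn_ge0 ?ler0n // ltW.
have {}N0 : 0 < N%:R :> R by rewrite ltr0n.
rewrite -(ler_pM2l N0).
have lo : N%:R * (N%:R ^+ 2 * cos om) <= \sum_x G x.
  apply: (@le_trans _ _ (\sum_(i < N) G (X i))).
    by rewrite mul_card; apply: ler_sum => i _; apply: G_X.
  rewrite -(big_imset G (in2W X_inj)) /= [leRHS](bigID (mem (X @: 'I_N))) /=.
  by rewrite lerDl sumr_ge0.
have hi : \sum_x G x <= \sum_j 2 ^+ d * \sum_j' rho ^+ #|supp j j'|.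
  rewrite exchange_big /=; apply: ler_sum => j _.
  rewrite exchange_big /= mulr_sumr; apply: ler_sum => j' _.
  exact: wt_bound.
rewrite mulrA (le_trans (ler_wpM2r (ltW e8) (le_trans lo hi))) //.
rewrite -mulr_sumr -[leLHS]mulrA [leRHS]mulrCA ler_pM2l ?exprn_gt0 //.
rewrite mulr_suml [leRHS]mul_card; apply: ler_sum => j _.
exact: sum_rho.
Qed.

End BinaryMatrix.

(* The alternatives are the cases where the pairs of columns at distance at most
   k, respectively larger than k, dominate; k is about d / 16 in the end. *)
Lemma binary_matrix_rank (R : realType) (q : nat) : prime q -> (4 < q)%N ->
  exists C : nat, forall N (M : 'I_N -> 'I_N -> bool) k,
    (forall i i', M i =1 M i' -> i = i') ->
    (forall j j', (forall i, M i j = M i j') -> j = j') ->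
    let d := binary_rank q M in
    (N ^ 2 * 8 ^ d <= C * (2 ^ d * (16 ^ k * 9 ^ d)))%N \/
    (N * (q ^ 2) ^ k.+1 <= C * (2 ^ d * (q ^ 2 - 2) ^ k.+1))%N.
Proof.
move=> pq q4; pose c : R := cos (pi / q%:R *+ 2).
have c0 : 0 < c := cos_om_gt0 pq R q4.
(* The 2 pays for replacing the sum of two terms by twice the larger one; [c] is the cosine in the
   lower bound. *)
exists (Num.bound (2 / c)) => N M k injr injc d; set C := Num.bound _.
have cC : 2 <= c * C%:R.
  by rewrite mulrC -ler_pdivrMr // ltW // archi_boundP // divr_ge0 // ltW.
have [f [_ [K VE]]] := colsub_row_free (\matrix_(i, j) (M i j)%:R : 'M['F_q]_N).
have := binary_matrix_bound pq injr injc VE R q4 k.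
rewrite -/(binary_rank q M) -/d -/c; set rho : R := cos _ => bound; clearbody d.
have e8 : 0 < 8 ^+ d :> R by rewrite exprn_gt0.
have e2 : 0 < 2 ^+ d :> R by rewrite exprn_gt0.
have q2 : (2 <= q ^ 2)%N by exact: (leq_mul (prime_gt1 pq) (prime_gt0 pq)).
have q0 : 0 < q%:R :> R by rewrite ltr0n prime_gt0.
have rho0 : 0 <= rho.
  by apply: le_trans (@norm_cos_le R q 1 _); rewrite // (ltn_trans _ q4).
have rhoq : rho * q%:R ^+ 2 <= (q ^ 2 - 2)%:R.
  rewrite natrB // natrX; have := ler_wpM2r (exprn_ge0 2 (ltW q0)) (cos_pi_div_le R (prime_gt0 pq)).
  by rewrite mulrBl mul1r divfK // expf_neq0 // gt_eqF.
have [le21|lt12] := lerP (N%:R * rho ^+ k.+1 * 8 ^+ d) (16 ^+ k * 9 ^+ d).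
  left; rewrite -(ler_nat R) !(natrM, natrX) -(ler_pM2l c0).
  have h : N%:R ^+ 2 * c * 8 ^+ d <= 2 ^+ d * (16 ^+ k * 9 ^+ d) * 2.
    rewrite (le_trans bound) // -[leRHS]mulrA ler_pM2l //; lra.
  rewrite mulrA [c * _]mulrC (le_trans h) // [leRHS]mulrA [leRHS]mulrC.
  by rewrite ler_pM2l // !mulr_gt0 ?exprn_gt0.
right; have [->|N0] := posnP N; first by rewrite mul0n.
have N0' : 0 < N%:R :> R by rewrite ltr0n.
have h : N%:R * c <= 2 ^+ d * rho ^+ k.+1 * 2.
  rewrite -(ler_pM2l N0') -(ler_pM2r e8).
  have -> : N%:R * (N%:R * c) * 8 ^+ d = N%:R ^+ 2 * c * 8 ^+ d by ring.
  rewrite (le_trans bound) //.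
  have -> : N%:R * (2 ^+ d * rho ^+ k.+1 * 2) * 8 ^+ d =
     2 ^+ d * (N%:R * rho ^+ k.+1 * 8 ^+ d * 2) by ring.
  rewrite ler_pM2l //; lra.
rewrite -(ler_nat R) !(natrM, natrX) -(ler_pM2l c0) mulrA [c * _]mulrC.
apply: (@le_trans _ _ (2 ^+ d * rho ^+ k.+1 * 2 * (q%:R ^+ 2) ^+ k.+1)).
  by rewrite ler_wpM2r // !exprn_ge0 // ltW.
have -> : 2 ^+ d * rho ^+ k.+1 * 2 * (q%:R ^+ 2) ^+ k.+1 =
    2 * (2 ^+ d * (rho * q%:R ^+ 2) ^+ k.+1) by rewrite [in RHS]exprMn; ring.
have z0 : 0 <= rho * q%:R ^+ 2 by rewrite mulr_ge0 // exprn_ge0 // ltW.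
rewrite [leRHS]mulrA; apply: ler_pM => //; first by rewrite mulr_ge0 ?exprn_ge0.
by rewrite ler_pM2l // lerXn2r // nnegrE (le_trans z0).
Qed.

(** * Oddtown families *)

Lemma row_free_row_inj (F : fieldType) m n (A : 'M[F]_(m, n)) :
  row_free A -> injective (fun i => row i A).
Proof.
move=> fA i j; rewrite !rowE => /(row_free_inj fA)/rowP/(_ i).
by rewrite !mxE !eqxx /=; case: (i =P j) => // _ /eqP; rewrite oner_eq0.
Qed.

Lemma mxrank_mxsub_le (F : fieldType) m n m' n' (g : 'I_m' -> 'I_m)
    (f : 'I_n' -> 'I_n) (A : 'M[F]_(m, n)) :
  (\rank (mxsub g f A) <= \rank A)%N.
Proof.
have le_row k k' r (h : 'I_k' -> 'I_k) (B : 'M[F]_(k, r)) :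
    (\rank (rowsub h B) <= \rank B)%N.
  by apply/mxrankS/row_subP => i; rewrite row_rowsub row_sub.
have -> : mxsub g f A = rowsub g (rowsub f A^T)^T.
  by apply/matrixP=> i j; rewrite !mxE.
by rewrite (leq_trans (le_row _ _ _ _ _)) // mxrank_tr -[leqRHS]mxrank_tr.
Qed.

(** Integer entries, to be read both in [rat] and in ['F_q]. *)
Definition incidence n (T : {set {set 'I_n}}) : 'M[int]_(#|T|, n) :=
  \matrix_(i, j) (j \in (enum_val i : {set 'I_n}))%:R.

Lemma incidence_gram n (T S : {set {set 'I_n}}) i j :
  (incidence T *m (incidence S)^T) i j =
    #|(enum_val i : {set 'I_n}) :&: enum_val j| :> int.
Proof.
rewrite mxE -[RHS]natz -[in RHS]sum1_card natr_sum [RHS]big_mkcond /=.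
by apply: eq_bigr => k _; rewrite !mxE inE; do 2!case: (k \in _).
Qed.

Lemma card_le_sum_cover (T : finType) (I : Type) (B : {set T}) (s : seq I)
    (G : I -> {set T}) :
  (forall x, x \in B -> has (fun i => x \in G i) s) ->
  (#|B| <= \sum_(i <- s) #|G i|)%N.
Proof.
elim: s B => [|i s IHs] B cov.
  by rewrite big_nil leqn0 cards_eq0; apply/eqP/setP=> x; rewrite inE; apply/negP=> /cov.
rewrite big_cons -(cardsID (G i) B) leq_add ?subset_leq_card ?subsetIr //.
by apply: IHs => x; rewrite inE => /andP[xi /cov]; rewrite /= (negPf xi).
Qed.

Section Oddtown.
Variables (l n : nat) (F : {set {set 'I_n}}).
Hypotheses (l0 : (0 < l)%N) (oF : oddtown l F).

Definition nondiv_part (q : nat) : {set {set 'I_n}} :=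
  [set A in F | ~~ (q ^ logn q l %| #|A|)%N].

Let oF_inter q A B : A \in F -> B \in F -> A != B ->
  (q ^ logn q l %| #|A :&: B|)%N.
Proof.
move=> AF BF AB; case/andP: oF => _ /forall_inP/(_ _ AF)/forall_inP/(_ _ BF).
by rewrite AB; apply: dvdn_trans; rewrite -p_part dvdn_part.
Qed.

Lemma oddtown_nondiv A : A \in F ->
  has (fun q => A \in nondiv_part q) (primes l).
Proof.
move=> AF; case/andP: oF => /forall_inP/(_ _ AF) + _; apply: contraR.
move=> /hasPn nd; apply/dvdn_partP => // q ql; have := nd q ql.
by rewrite inE AF /= negbK p_part.
Qed.

Lemma card_oddtown_le : (#|F| <= \sum_(q <- primes l) #|nondiv_part q|)%N.
Proof. by apply: card_le_sum_cover => A /oddtown_nondiv. Qed.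

Lemma incidence_row_free p (S : {set {set 'I_n}}) : prime p ->
  S \subset nondiv_part p ->
  row_free (map_mx intr (incidence S) : 'M[rat]_(_, _)).
Proof.
move=> pp /subsetP SF; apply: (@row_free_diag_gram _ _ _ p (logn p l)) => //.
  move=> i j ij; rewrite incidence_gram.
  have := SF _ (enum_valP i); have := SF _ (enum_valP j).
  rewrite !inE => /andP[jF _] /andP[iF _].
  by apply: oF_inter; rewrite // (inj_eq enum_val_inj).
move=> i; rewrite incidence_gram setIid.
by have := SF _ (enum_valP i); rewrite inE => /andP[].
Qed.

Lemma nondiv_part_bound (q : nat) : q \in primes l ->
  (#|nondiv_part q| +
    (\rank (map_mx intr (incidence (F :\: nondiv_part q)) : 'M['F_q]_(_, _))).*2
     <= n)%N.
Proof.
move=> qp; set S := F :\: _; have pq : prime q by move: qp; rewrite mem_primes => /andP[].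
have inS (i : 'I_#|S|) : enum_val i \in F /\ (q ^ logn q l %| #|enum_val i|)%N.
  by have := enum_valP i; rewrite !inE => /andP[+ iF]; rewrite iF negbK.
have inT (i : 'I_#|nondiv_part q|) :
    enum_val i \in F /\ ~~ (q ^ logn q l %| #|enum_val i|)%N.
  by have := enum_valP i; rewrite !inE => /andP.
apply: (@oddtown_isotropic_bound _ _ _ (incidence (nondiv_part q)) _ _ (logn q l)) => //.
- by rewrite logn_gt0.
- move=> i j ij; rewrite incidence_gram.
  apply: oF_inter; rewrite ?(inj_eq enum_val_inj) //.
    by case: (inT i).
  by case: (inT j).
- by move=> i; rewrite incidence_gram setIid; case: (inT i).
- move=> i j; rewrite incidence_gram.
  have [iF iq] := inT i; have [jF jq] := inS j.
  by apply: oF_inter => //; apply: contraNneq iq => ->.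
move=> i j; rewrite incidence_gram.
have [iF iq] := inS i; have [jF jq] := inS j.
have [->|ij] := eqVneq (enum_val i) (enum_val j); first by rewrite setIid.
exact: oF_inter.
Qed.

(** Pigeonhole: [F] has at least (omega - 1/2) n members and F_q at most n, so at least (omega -
    3/2) n remain for omega - 1 other primes; this is at least (omega - 1) n / 2 as omega >= 2. *)
Lemma large_nondiv_part q : (1 < omega l)%N ->
  ((omega l).*2.-1 * n <= #|F|.*2)%N -> q \in primes l ->
  exists2 p, p \in primes l & (n <= #|nondiv_part p :\: nondiv_part q|.*2)%N.
Proof.
move=> w2 bigF ql; pose P p := (n <= #|nondiv_part p :\: nondiv_part q|.*2)%N.
suff /hasP[p pl pP] : has P (primes l) by exists p.
apply: contraT => /hasPn small.
have Fq : (#|nondiv_part q| <= n)%N.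
  exact: leq_trans (leq_addr _ _) (nondiv_part_bound ql).
have n0 : (0 < n)%N by have := small q ql; rewrite /P -ltnNge; apply: leq_ltn_trans.
have FD : (#|F :\: nondiv_part q| <=
        \sum_(p <- rem q (primes l)) #|nondiv_part p :\: nondiv_part q|)%N.
  apply: card_le_sum_cover => A; rewrite inE => /andP[nA AF].
  have /hasP[p pl Ap] := oddtown_nondiv AF; apply/hasP; exists p.
    by rewrite (mem_rem_uniq _ (primes_uniq l)) inE pl andbT; apply: contraNneq nA => <-.
  by rewrite inE nA.
(* Twice the size of a small part is at most n - 1, which gives the strict inequality needed when
   omega = 2. *)
have : ((\sum_(p <- rem q (primes l)) #|nondiv_part p :\: nondiv_part q|).*2
   <= (omega l).-1 * n.-1)%N.
  rewrite -(size_rem ql) -mul2n big_distrr /=.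
  have : all (fun p => ~~ P p) (rem q (primes l)).
    by apply/allP=> p /mem_rem; apply: small.
  elim: (rem q _) => [|p s IHs]; first by rewrite big_nil.
  rewrite big_cons => /andP[pP /IHs]; move: pP; rewrite /P /= -ltnNge.
  by move=> lt le; rewrite mulSn leq_add //; lia.
have := cardsID (nondiv_part q) F.
have : (#|F :&: nondiv_part q| <= #|nondiv_part q|)%N by rewrite subset_leq_card // subsetIr.
move: w2 bigF; rewrite /omega; case: (size _) => [|[|w]] //= _ bigF FI FE.
move=> SD; have := prednK n0; move: n.-1 bigF Fq FI FE FD SD => m.
move: #|_ :\: _| #|_ :&: _| #|nondiv_part q| #|F| (\sum_(_ <- _) _)%N => a b c e s.
move=> bigF Fq FI FE FD SD mE; rewrite -mE in bigF Fq; nia.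
Qed.

(** [M] is a square submatrix, nonsingular over [rat], of the incidence matrix of F_p \ F_q;
    nonsingularity is kept only as distinctness of rows and of columns. The rows come from F \ F_q,
    which bounds the rank mod q by d. *)
Lemma oddtown_binary_matrix q : (1 < omega l)%N ->
  ((omega l).*2.-1 * n <= #|F|.*2)%N -> q \in primes l ->
  exists d N (M : 'I_N -> 'I_N -> bool),
    [/\ (n <= N.*2)%N, (#|nondiv_part q| + d.*2 <= n)%N,
        forall i i', M i =1 M i' -> i = i',
        forall j j', (forall i, M i j = M i j') -> j = j' &
        (binary_rank q M <= d)%N].
Proof.
move=> w2 bigF ql; have [p pl nN] := large_nondiv_part w2 bigF ql.
set T := nondiv_part p :\: nondiv_part q in nN.
have pp : prime p by move: pl; rewrite mem_primes => /andP[].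
have Tfree := incidence_row_free pp (subsetDl _ (nondiv_part q)).
have [f []] := colsub_row_free (map_mx intr (incidence T) : 'M[rat]_(_, _)).
move: f; rewrite (eqP Tfree : \rank _ = #|T|) => f ffree _.
pose M (i j : 'I_#|T|) := f j \in (enum_val i : {set 'I_n}).
exists (\rank (map_mx intr (incidence (F :\: nondiv_part q)) : 'M['F_q]_(_, _))), #|T|, M.
split=> //; first exact: nondiv_part_bound.
- have rfree : row_free (colsub f (map_mx intr (incidence T) : 'M[rat]_(_, _))).
    by rewrite /row_free -mxrank_tr.
  move=> i i' MM; apply: (row_free_row_inj rfree); apply/rowP=> j.
  by rewrite !mxE; have := MM j; rewrite /M => ->.
- move=> j j' MM; apply: (row_free_row_inj ffree); apply/rowP=> i.
  by rewrite !mxE; have := MM i; rewrite /M => ->.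
have TS : T \subset F :\: nondiv_part q.
  by apply: setSD; apply/subsetP=> A; rewrite inE => /andP[].
pose g i := enum_rank_in (subsetP TS _ (enum_valP i)) (enum_val i).
rewrite /binary_rank (_ : \matrix_(i, j) _ =
  mxsub g f (map_mx intr (incidence (F :\: nondiv_part q)))).
  exact: mxrank_mxsub_le.
apply/matrixP=> i j; rewrite !mxE enum_rankK_in ?(subsetP TS) ?enum_valP //.
by rewrite /M; case: (_ \in _).
Qed.

End Oddtown.

Local Close Scope ring_scope.

(** * Logarithmic estimates *)

From mathcomp Require Import Rstruct.
From Stdlib Require Import Reals Lra.

(* The homonymous tactics of algebra-tactics do not see Stdlib's operations. *)
Local Tactic Notation "lra" := Lra.lra.
Local Tactic Notation "nra" := Lra.nra.

Local Notation "m ^ n" := (expn m n) : nat_scope.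
Local Notation lnN m := (ln (INR m)).

Lemma INR_gt0 n : 0 < n -> (0 < INR n)%R.
Proof. by move=> n0; apply: lt_0_INR; lia. Qed.

Lemma INR_le m n : m <= n -> (INR m <= INR n)%R.
Proof. by move=> mn; apply: le_INR; lia. Qed.

Lemma lnN_le m n : 0 < m -> m <= n -> (lnN m <= lnN n)%R.
Proof.
move=> m0 /INR_le; case=> [lt | ->]; last exact: Rle_refl.
by apply/Rlt_le/ln_increasing => //; apply: INR_gt0.
Qed.

Lemma lnN_mul m n : 0 < m -> 0 < n -> lnN (m * n) = (lnN m + lnN n)%R.
Proof. by move=> m0 n0; rewrite mult_INR ln_mult //; apply: INR_gt0. Qed.

Lemma lnN_exp m k : 0 < m -> lnN (m ^ k) = (INR k * lnN m)%R.
Proof.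
move=> m0; elim: k => [|k IHk]; first by rewrite expn0 ln_1 Rmult_0_l.
by rewrite expnS lnN_mul ?expn_gt0 ?m0 // IHk S_INR; lra.
Qed.

Lemma lnN2_bounds : (0 < lnN 2 < 1)%R.
Proof.
have ->: INR 2 = 2%R by rewrite /=; lra.
split; first by rewrite -ln_1; apply: ln_increasing; lra.
by rewrite -[X in (_ < X)%R]ln_exp; apply: ln_increasing; have := exp_ineq1 1; lra.
Qed.

(** 3/2 = 1 + 1/4 + 1/4: from 16^k = 2^(4k) with 4k <= d/4, and from log2(9/8) <= 1/4, as 9^4 <= 2 *
    8^4. *)
Lemma ln_rank_bound_near C N d k : 0 < C -> 0 < N -> 16 * k <= d ->
  N ^ 2 * 8 ^ d <= C * (2 ^ d * (16 ^ k * 9 ^ d)) ->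
  (2 * lnN N <= lnN C + 3 / 2 * INR d * lnN 2)%R.
Proof.
move=> C0 N0 kd h.
have := lnN_le _ h; rewrite !lnN_mul ?muln_gt0 ?expn_gt0 ?C0 ?N0 // !lnN_exp //.
move=> /(_ isT).
have -> : lnN 16 = (4 * lnN 2)%R.
  by rewrite (@lnN_exp 2 4 isT); congr Rmult; rewrite /=; lra.
have h98 : (4 * lnN 9 <= 4 * lnN 8 + lnN 2)%R.
  have : 9 ^ 4 <= 8 ^ 4 * 2 by [].
  move/lnN_le => /(_ isT); rewrite lnN_mul // !lnN_exp //.
  by have -> : INR 4 = 4%R by rewrite /=; lra.
have I2 : INR 2 = 2%R by rewrite /=; lra.
rewrite I2 in h98 *; have := INR_le kd; rewrite mult_INR; have -> : INR 16 = 16%R by rewrite /=; lra.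
have d0 := pos_INR d; have := lnN2_bounds.
have -> : INR 2 = 2%R by rewrite /=; lra.
move=> [l0 _] kd' bd; have h1 := Rmult_le_compat_l _ _ _ d0 h98.
have h2 := Rmult_le_compat_r _ _ _ (Rlt_le _ _ l0) kd'.
lra.
Qed.

(** From ln(1 - 2/q^2) <= -2/q^2 taken k + 1 >= d/16 times, the gain is at least d/(8 q^2); a factor
    ln 2 < 1 is then inserted. *)
Lemma ln_rank_bound_far q C N d k : 0 < C -> 0 < N -> 1 < q -> d <= 16 * k.+1 ->
  N * (q ^ 2) ^ k.+1 <= C * (2 ^ d * (q ^ 2 - 2) ^ k.+1) ->
  (lnN N <= lnN C + INR d * lnN 2 * (1 - / 8 * / INR q ^ 2))%R.
Proof.
move=> C0 N0 q1 dk h.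
have q2 : 2 < q ^ 2 by rewrite -mulnn; nia.
have q20 : 0 < q ^ 2 by lia.
have qq0 : 0 < q ^ 2 - 2 by lia.
have e0 m j : 0 < m -> 0 < m ^ j by move=> m0; rewrite expn_gt0 m0.
have p1 : 0 < N * (q ^ 2) ^ k.+1 by rewrite muln_gt0 N0 e0.
have p2 : 0 < 2 ^ d * (q ^ 2 - 2) ^ k.+1 by rewrite muln_gt0 !e0.
have := lnN_le p1 h; rewrite (lnN_mul N0 (e0 _ _ q20)) (lnN_mul C0 p2).
rewrite (lnN_mul (e0 2 d isT) (e0 _ _ qq0)) (lnN_exp _ q20) (lnN_exp _ qq0).
rewrite (@lnN_exp 2 d) //.
have Q0 : (0 < INR (q ^ 2))%R by apply: INR_gt0.
have QE : INR (q ^ 2) = (INR q ^ 2)%R by rewrite expnS expn1 mult_INR /=; lra.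
have Q1 : (0 < INR (q ^ 2 - 2))%R by apply: INR_gt0.
have QB : INR (q ^ 2 - 2) = (INR (q ^ 2) - 2)%R by rewrite minus_INR; [rewrite /=; lra | lia].
rewrite -QE; set Q := INR (q ^ 2) in Q0 QE Q1 QB *; set u := (/ Q)%R.
have u0 : (0 < u)%R by apply: Rinv_0_lt_compat.
have gap : (lnN (q ^ 2 - 2) <= ln Q - 2 * u)%R.
  have -> : INR (q ^ 2 - 2) = (Q * ((Q - 2) * u))%R.
    rewrite QB /u; have := Rinv_r Q; nra.
  have w0 : (0 < (Q - 2) * u)%R by apply: Rmult_lt_0_compat => //; rewrite -QB.
  rewrite ln_mult //; have := exp_ineq1_le (ln ((Q - 2) * u)).
  rewrite exp_ln //; have := Rinv_l Q; rewrite -/u; nra.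
have [l0 l1] := lnN2_bounds.
have dk' : (INR d <= 16 * INR k.+1)%R.
  have := INR_le dk; rewrite mult_INR; have -> : INR 16 = 16%R by rewrite /=; lra.
  by [].
have d0 := pos_INR d; move: (INR d) (INR k.+1) (lnN 2) (lnN C) (lnN N) (ln Q)
  (lnN (q ^ 2 - 2)) gap l0 l1 dk' d0 => D K L c x y z gap l0 l1 dk' d0 bd.
have K0 : (0 <= K)%R by lra.
have h1 := Rmult_le_compat_l K _ _ K0 gap.
have h2 : (D * u <= 16 * K * u)%R by apply: Rmult_le_compat_r; lra.
have h3 : (D * u * L <= D * u * 1)%R by apply: Rmult_le_compat_l; nra.
nra.
Qed.

Lemma rank_log_bound q : prime q -> 4 < q ->
  exists2 K : R, (0 <= K)%R & forall N (M : 'I_N -> 'I_N -> bool), 0 < N ->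
    (forall i i', M i =1 M i' -> i = i') ->
    (forall j j', (forall i, M i j = M i j') -> j = j') ->
    ((2 + / 10 * / INR q ^ 2) * lnN N - K <=
      2 * INR (binary_rank q M) * lnN 2)%R.
Proof.
move=> pq q4; have [C HC] := binary_matrix_rank Rdefinitions.R pq q4.
have c0 : (0 <= lnN C.+1)%R by rewrite -ln_1; apply: (@lnN_le 1).
(* With u = 1/q^2 <= 1, the 3 dominates 2 + u/10. The coefficient 2 + u/10 works since (2 + u/10)(1
   - u/8) <= 2 in the far case and 3/4 of 2 + u/10 is below 2 in the near one. [C.+1] keeps the
   argument of the logarithm positive. *)
exists (3 * lnN C.+1)%R; first lra.
move=> N M N0 injr injc; set d := binary_rank q M.
have q1 : 1 < q := prime_gt1 pq.
have q0 : (1 <= INR q)%R by apply: (@INR_le 1); lia.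
have u0 : (0 < / INR q ^ 2)%R by apply/Rinv_0_lt_compat/pow_lt; lra.
have u1 : (/ INR q ^ 2 <= 1)%R.
  by rewrite -[X in (_ <= X)%R]Rinv_1; apply: Rinv_le_contravar; rewrite /=; nra.
have [l0 _] := lnN2_bounds; have d0 := pos_INR d.
have dL : (0 <= INR d * lnN 2)%R by nra.
(* k = d / 16 rounded down meets the side conditions of both cases. *)
have kd : 16 * (d %/ 16) <= d by rewrite mulnC leq_trunc_div.
have dk : d <= 16 * (d %/ 16).+1 by rewrite mulnC ltnW // ltn_ceil.
have Cle m m' : m <= C * m' -> m <= C.+1 * m'.
  by move=> h; apply: leq_trans h _; rewrite leq_mul2r leqnSn orbT.
have [/Cle h|/Cle h] := HC N M (d %/ 16) injr injc.
  have := ln_rank_bound_near (ltn0Sn C) N0 kd h; nra.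
have := ln_rank_bound_far (ltn0Sn C) N0 q1 dk h.
move: (/ INR q ^ 2)%R (lnN C.+1) (lnN N) u0 u1 c0 => u c x u0 u1 c0.
rewrite -/d => h'.
have -> : (2 * INR d * lnN 2 = 2 * (INR d * lnN 2))%R by lra.
move: (INR d * lnN 2)%R dL h' => y dL h'.
have h1 : ((2 + / 10 * u) * x <= (2 + / 10 * u) * (c + y * (1 - / 8 * u)))%R.
  by apply: Rmult_le_compat_l => //; lra.
have uy : (0 <= u * y)%R by apply: Rmult_le_pos => //; lra.
have uuy : (0 <= u * (u * y))%R by apply: Rmult_le_pos => //; lra.
have uc : (0 <= (1 - u) * c)%R by apply: Rmult_le_pos => //; lra.
lra.
Qed.

(** * The extra gain at each prime and its sum *)

(** The dropped smallest odd prime is at least 3, and q is a larger odd number. *)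
Lemma Pstar_odd_gt4 l q : q \in Pstar_odd l -> 4 < q.
Proof.
rewrite /Pstar_odd; have : all (fun p => prime p && odd p) (odd_primes l).
  by apply/allP=> p; rewrite mem_filter mem_primes => /and3P[-> ->].
have : sorted ltn (odd_primes l) by apply: sorted_filter (sorted_primes l); exact: ltn_trans.
case: (odd_primes l) => //= h t /(order_path_min ltn_trans)/allP ht.
case/andP=> /andP[ph oh] /allP ot qt.
have hq : h < q := ht q qt; have /andP[_ oq] := ot q qt.
have h1 := prime_gt1 ph; case: h h1 hq oh {ph ht} => [|[|[|h]]] //= _ hq _.
by case: q hq oq {ot qt} => [|[|[|[|[|q]]]]].
Qed.

Lemma Pstar_odd_primes l : Pstar_odd l = [seq q <- primes l | q \in Pstar_odd l].
Proof.
apply/(subseq_uniqP (primes_uniq l)).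
by rewrite /Pstar_odd -drop1; apply: subseq_trans (drop_subseq _ _) (filter_subseq _ _).
Qed.

(** The gain at [q] over the coefficient 2 of the logarithm. The factor 1/10 makes the total
    [2 * eps l]; one [eps l] is spent later on absorbing constants. *)
Definition weight (l q : nat) : R := if q \in Pstar_odd l then (/ 10 * / INR q ^ 2)%R else 0%R.

Lemma sum_weight l : foldr (fun (q : nat) acc => weight l q + acc)%R 0%R (primes l) = (2 * eps l)%R.
Proof.
rewrite /eps Pstar_odd_primes /weight; elim: (primes l) => [|q s IHs] /=; first by lra.
by case: ifP => _ /=; rewrite IHs /=; lra.
Qed.

Lemma eps_gt0 l : 2 <= size (odd_primes l) -> (0 < eps l)%R.
Proof.
move=> s2; rewrite /eps; have := @Pstar_odd_gt4 l.
have : 0 < size (Pstar_odd l) by rewrite size_behead; lia.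
case: (Pstar_odd l) => //= p s _ gt4.
have pos q : 4 < q -> (0 < / (INR q ^ 2))%R.
  by move=> q4; apply/Rinv_0_lt_compat/pow_lt/INR_gt0; lia.
have := pos p (gt4 p (mem_head _ _)).
suff : (0 <= foldr (fun p acc => / (INR p ^ 2) + acc) 0 s)%R by rewrite /=; lra.
have : {in s, forall q, 4 < q} by move=> q qs; apply: gt4; rewrite inE qs orbT.
elim: s {gt4} => [|q s IHs] h /=; first by lra.
have := pos q (h q (mem_head _ _)).
have := IHs (fun r rs => h r (mem_behead (s := q :: s) rs)); rewrite /=; lra.
Qed.

Lemma nondiv_part_log_bound l q : 0 < l -> 1 < omega l -> q \in primes l ->
  exists K : R, forall n (F : {set {set 'I_n}}), 0 < n -> oddtown l F ->
    (omega l).*2.-1 * n <= #|F|.*2 ->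
    (INR #|nondiv_part l F q| <=
      INR n - (2 + weight l q) * log2 (INR n) + K)%R.
Proof.
move=> l0 w2 ql; have pq : prime q by move: ql; rewrite mem_primes => /andP[].
have [L0 _] := lnN2_bounds; have L0' := L0.
have [w0 [K K0 HK]] : (0 <= weight l q)%R /\ exists2 K : R, (0 <= K)%R &
  forall N (M : 'I_N -> 'I_N -> bool), 0 < N ->
    (forall i i', M i =1 M i' -> i = i') ->
    (forall j j', (forall i, M i j = M i j') -> j = j') ->
    ((2 + weight l q) * lnN N - K <=
      2 * INR (binary_rank q M) * lnN 2)%R.
  rewrite /weight; case: ifP => [/Pstar_odd_gt4 q4 | _].
    split; last exact: rank_log_bound.
    have : (0 < / INR q ^ 2)%R by apply/Rinv_0_lt_compat/pow_lt/INR_gt0; lia.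
    lra.
  split; first lra.
  exists 0%R => [|N M N0 injr injc]; first lra.
  have := lnN_le N0 (le_exp_binary_rank q injr); rewrite lnN_exp //; lra.
(* The loss [2 + weight l q] comes from log2 N >= log2 n - 1; dividing by ln 2 changes the base. *)
exists (2 + weight l q + K / lnN 2)%R => n F n0 oF bigF.
have [d [N [M [nN nd injr injc rd]]]] := oddtown_binary_matrix l0 oF w2 bigF ql.
have N0 : 0 < N by lia.
have := HK N M N0 injr injc; have := INR_le rd.
have := INR_le nd; rewrite -mul2n plus_INR mult_INR.
have : (lnN n <= lnN N + lnN 2)%R.
  by rewrite -lnN_mul //; apply: lnN_le; lia.
have -> : log2 (INR n) = (lnN n / lnN 2)%R by rewrite /log2 /=; congr (_ / ln _)%R; lra.
move: (binary_rank q M) => r nN' nd' rd' h.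
have I2 : INR 2 = 2%R by rewrite /=; lra.
rewrite I2 in nd'.
have h2 : ((2 + weight l q) * (lnN n / lnN 2) <= 2 * INR d + (2 + weight l q + K / lnN 2))%R.
  apply: (Rmult_le_reg_r (lnN 2)) => //.
  have h3 := Rmult_le_compat_l (2 + weight l q) _ _ (ltac:(lra)) nN'.
  have h4 := Rmult_le_compat_r _ _ _ (Rlt_le _ _ L0) rd'.
  have iL : (/ lnN 2 * lnN 2 = 1)%R by apply: Rinv_l; lra.
  rewrite /Rdiv !Rmult_plus_distr_r !Rmult_assoc iL !Rmult_1_r.
  lra.
lra.
Qed.

(** As ln x <= 2 sqrt x, n >= a^2 with a = 4A / ln 2 gives the first bound; n >= b gives the
    second. *)
Lemma eventually_log (A K e : R) : (0 <= A)%R -> (0 < e)%R ->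
  exists n0 : nat, forall n, n0 <= n ->
    [/\ 0 < n, (A * log2 (INR n) <= INR n / 2)%R & (K <= e * log2 (INR n))%R].
Proof.
move=> A0 e0; have L0 : (0 < ln 2)%R by rewrite -ln_1; apply: ln_increasing; lra.
pose a := (4 * A / ln 2)%R; pose b := exp (K * ln 2 / e).
have [n0 Hn0] := INR_unbounded (a * a + b).
exists n0 => n /INR_le n0n.
have b0 : (0 < b)%R by apply: exp_pos.
have a0 : (0 <= a)%R by rewrite /a; apply: Rle_mult_inv_pos => //; lra.
have x0 : (0 < INR n)%R by nra.
have n1 : 0 < n by move: x0; case: (n) => //=; lra.
split=> //.
  have s0 := sqrt_lt_R0 _ x0.
  have xs : (INR n = sqrt (INR n) * sqrt (INR n))%R by rewrite sqrt_sqrt //; lra.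
  have as' : (a <= sqrt (INR n))%R by rewrite -(sqrt_square a) //; apply: sqrt_le_1; nra.
  have lns : (ln (INR n) <= 2 * sqrt (INR n))%R.
    rewrite {1}xs ln_mult //; have := exp_ineq1_le (ln (sqrt (INR n))).
    rewrite exp_ln //; lra.
  have -> : (A * log2 (INR n) = a / 4 * ln (INR n))%R by rewrite /log2 /a; field; lra.
  nra.
have lnb : (K * ln 2 / e <= ln (INR n))%R.
  by rewrite -(ln_exp (K * ln 2 / e)) -/b; apply/Rlt_le/ln_increasing; nra.
have -> : K = (e * ((K * ln 2 / e) / ln 2))%R by field; lra.
apply: Rmult_le_compat_l; first lra.
by apply: Rmult_le_compat_r => //; apply/Rlt_le/Rinv_0_lt_compat.
Qed.

Theorem theorem1p2 (l : nat) (hl : 0 < l) (hodd : 2 <= size (odd_primes l)) :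
  exists n0 : nat, forall n : nat, n0 <= n ->
    (INR (f_oddtown l n) <= INR (omega l) * INR n
                    - (2 * INR (omega l) + eps l) * log2 (INR n))%R.
Proof.
have e0 := eps_gt0 hodd.
have w2 : 1 < omega l.
  by apply: leq_trans hodd _; rewrite size_filter count_size.
(* For large families the gain is [2 * eps l], and [K] depends on [l] alone. *)
have [K HK] : exists K : R, forall n (F : {set {set 'I_n}}), 0 < n -> oddtown l F ->
    (omega l).*2.-1 * n <= #|F|.*2 ->
    (INR #|F| <= INR (omega l) * INR n -
      (2 * INR (omega l) + 2 * eps l) * log2 (INR n) + K)%R.
  suff [K HK] : exists K : R, forall n (F : {set {set 'I_n}}), 0 < n -> oddtown l F ->
    (omega l).*2.-1 * n <= #|F|.*2 ->
    (INR (\sum_(q <- primes l) #|nondiv_part l F q|) <= INR (size (primes l)) * INR n -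
      (2 * INR (size (primes l)) +
       foldr (fun (q : nat) acc => weight l q + acc) 0 (primes l)) * log2 (INR n) + K)%R.
    exists K => n F n0 oF bigF; have := HK n F n0 oF bigF; rewrite sum_weight.
    by have := INR_le (card_oddtown_le hl oF); rewrite /omega; lra.
  have : {subset primes l <= primes l} by [].
  (* Induction on the list summed over; the right-hand side of the inclusion keeps the full
     [primes l]. *)
  elim: {1 3 4 5 6}(primes l) => [|q s IHs] sub.
    by exists 0%R => n F _ _ _; rewrite big_nil /=; lra.
  have [K1 HK1] := IHs (fun r rs => sub r (mem_behead (s := q :: s) rs)).
  have [K2 HK2] := nondiv_part_log_bound hl w2 (sub q (mem_head _ _)).
  exists (K1 + K2)%R => n F n0 oF bigF; rewrite big_cons plus_INR [size _]/= S_INR /=.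
  have := HK1 n F n0 oF bigF; have := HK2 n F n0 oF bigF.
  move: (foldr _ _ _) (weight l q) (log2 (INR n)) (INR #|nondiv_part l F q|)
    (INR (\sum_(j <- s) #|nondiv_part l F j|)) => W w L a b.
  lra.
have A0 : (0 <= 2 * INR (omega l) + eps l)%R by have := pos_INR (omega l); lra.
(* One eps log2 n absorbs [K]; the bound n/2 on the whole logarithmic term settles small families,
   which fall short of omega n by n/2. *)
have [n0 Hn0] := eventually_log K A0 e0.
exists n0 => n /Hn0[n1 logn Klog].
have main (F : {set {set 'I_n}}) : oddtown l F ->
    (INR #|F| <= INR (omega l) * INR n
                    - (2 * INR (omega l) + eps l) * log2 (INR n))%R.
  move=> oF; have [bigF|smallF] := leqP ((omega l).*2.-1 * n) (#|F|.*2).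
    by have := HK n F n1 oF bigF; lra.
  have : (2 * INR #|F| <= (2 * INR (omega l) - 1) * INR n)%R.
    have I2 : INR 2 = 2%R by rewrite /=; lra.
    have -> : (2 * INR (omega l) - 1)%R = INR (omega l).*2.-1.
      by rewrite -subn1 -mul2n minus_INR; [rewrite mult_INR I2 | lia].
    by rewrite -{1}I2 -!mult_INR; apply: INR_le; lia.
  lra.
(* The maximum starts at 0, so the bound must be shown nonnegative: the empty family does this. *)
apply: (big_ind (fun m => (INR m <= _)%R)) => [|x y hx hy|F]; last exact: main.
  have -> : 0 = #|(set0 : {set {set 'I_n}})| by rewrite cards0.
  by apply: main; apply/andP; split; apply/forall_inP=> A; rewrite inE.
by rewrite /maxn; case: ifP.
Qed.
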